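(* Let $f(x)=Ax^2+Bx+C\in\mathbb{Z}[x]$ be an irreducible quadratic polynomial. Then there are at most finitely many primes $\ell$ such that there exists a root of $f(x)$ in $\mathbb{Q}_\ell$ with a periodic Ruban continued fraction expansion.
   Context: For a prime $\ell$ and $\alpha\in\mathbb{Q}_\ell$, the $\ell$-adic integral part $\lfloor\alpha\rfloor_\ell$ is the unique $a\in\mathbb{Z}[1/\ell]$ with $0\le a<\ell$ and $|\alpha-a|_\ell<1$, where $|\cdot|_\ell$ is the $\ell$-adic absolute value. The Ruban continued fraction expansion of $\alpha$ in $\mathbb{Q}_\ell$ is defined by $\alpha_0:=\alpha$, $a_n:=\lfloor\alpha_n\rfloor_\ell$, $r_n:=\alpha_n-a_n$, and $\alpha_{n+1}:=1/r_n$ whenever $r_n\neq 0$; if $r_n=0$ the procedure stops. ''Periodic'' means infinite and eventually periodic: there are $N\ge 0$ and $k\ge 1$ with $a_{n+k}=a_n$ for all $n\ge N$. *)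

(* Defs.v *)
From HB Require Import structures.
From mathcomp Require Import all_boot all_order all_algebra.
From mathcomp Require Import ring lra zify.
From mathcomp Require Import boolp classical_sets functions cardinality.

Set Implicit Arguments.
Unset Strict Implicit.
Unset Printing Implicit Defensive.

Import Order.TTheory GRing.Theory Num.Theory.
Local Open Scope ring_scope.

(* Everything below is parametrised by an arbitrary [p : nat].  If [p] is not
   prime then [logn p n = 0], so [padic_abs p] is the trivial absolute value;
   only the case of a prime [p] is meaningful, but the completion is a field
   for every [p]. *)

Section PadicAbs.
Variable p : nat.

Definition padic_val (x : rat) : int :=
  (logn p `|numq x|)%:Z - (logn p `|denq x|)%:Z.

Definition padic_abs (x : rat) : rat :=
  if x == 0 then 0 else p%:R ^ (- padic_val x).

Lemma padic_val_frac (m n : int) : m != 0 -> n != 0 ->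
  padic_val (m%:~R / n%:~R) = (logn p `|m|)%:Z - (logn p `|n|)%:Z.
Proof.
move=> m0 n0; set x : rat := _ / _.
have n0' : n%:~R != 0 :> rat by rewrite intr_eq0.
have x0 : x != 0 by rewrite mulf_neq0 ?invr_eq0 ?intr_eq0.
have E : numq x * n = m * denq x.
  apply/eqP; rewrite -(eqr_int rat) !rmorphM /=; apply/eqP.
  by rewrite numqE {1}/x mulrAC divfK.
have := congr1 (fun z : int => logn p `|z|) E; rewrite /padic_val !abszM.
rewrite !lognM ?absz_gt0 ?numq_eq0 ?denq_neq0 //; lia.
Qed.

Lemma logn_nprime n : ~~ prime p -> logn p n = 0%N.
Proof. by move=> /negPf np; rewrite lognE np. Qed.

Lemma padic_val0F : ~~ prime p -> forall x, padic_val x = 0.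
Proof. by move=> np x; rewrite /padic_val !logn_nprime. Qed.

Lemma padic_absE x : x != 0 -> padic_abs x = p%:R ^ (- padic_val x).
Proof. by rewrite /padic_abs => /negPf ->. Qed.

Lemma padic_abs_0 : padic_abs 0 = 0. Proof. by rewrite /padic_abs eqxx. Qed.

Lemma padic_abs_gt0 x : x != 0 -> 0 < padic_abs x.
Proof.
move=> x0; rewrite padic_absE //; have [pp|np] := boolP (prime p).
  by rewrite exprz_gt0 // ltr0n prime_gt0.
by rewrite padic_val0F.
Qed.

Lemma padic_abs_ge0 x : 0 <= padic_abs x.
Proof.
have [->|/padic_abs_gt0/ltW//] := eqVneq x 0; by rewrite padic_abs_0.
Qed.

Lemma padic_abs_1 : padic_abs 1 = 1.
Proof. by rewrite padic_absE // /padic_val logn1 subrr. Qed.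

Lemma padic_absN x : padic_abs (- x) = padic_abs x.
Proof. by rewrite /padic_abs oppr_eq0 /padic_val numqN denqN abszN. Qed.

Lemma padic_valM x y : x != 0 -> y != 0 ->
  padic_val (x * y) = padic_val x + padic_val y.
Proof.
move=> x0 y0; have -> : x * y =
    (numq x * numq y)%:~R / (denq x * denq y)%:~R.
  by rewrite -{1}[x]divq_num_den -{1}[y]divq_num_den !rmorphM /= mulf_div.
rewrite padic_val_frac ?mulf_neq0 ?numq_eq0 ?denq_neq0 //.
rewrite /padic_val !abszM !lognM ?absz_gt0 ?numq_eq0 ?denq_neq0 //; lia.
Qed.

Lemma padic_absM x y : padic_abs (x * y) = padic_abs x * padic_abs y.
Proof.
have [->|x0] := eqVneq x 0; first by rewrite mul0r padic_abs_0 mul0r.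
have [->|y0] := eqVneq y 0; first by rewrite mulr0 padic_abs_0 mulr0.
rewrite !padic_absE ?mulf_neq0 // padic_valM // opprD.
have [pp|np] := boolP (prime p); last by rewrite !padic_val0F // mulr1.
by rewrite expfzDr // pnatr_eq0 -lt0n prime_gt0.
Qed.

Lemma logn_addz (m n : int) : m + n != 0 -> m != 0 -> n != 0 ->
  (minn (logn p `|m|) (logn p `|n|) <= logn p `|(m + n)%R|)%N.
Proof.
move=> mn0 m0 n0; have [pp|np] := boolP (prime p); last first.
  by rewrite !logn_nprime.
have D (z : int) k : z != 0 -> (k <= logn p `|z|)%N = (p ^ k %| `|z|)%N.
  by move=> z0; rewrite pfactor_dvdn // absz_gt0.
set k := minn _ _; rewrite D //.
suff : (Posz (p ^ k) %| m + n)%Z by [].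
by apply: rpredD; [have := geq_minl (logn p `|m|) (logn p `|n|)
  | have := geq_minr (logn p `|m|) (logn p `|n|)]; rewrite D.
Qed.

Lemma padic_absD x y :
  padic_abs (x + y) <= Num.max (padic_abs x) (padic_abs y).
Proof.
have [->|x0] := eqVneq x 0; first by rewrite add0r le_max lexx orbT.
have [->|y0] := eqVneq y 0; first by rewrite addr0 le_max lexx.
have [->|xy0] := eqVneq (x + y) 0.
  by rewrite padic_abs_0 le_max padic_abs_ge0.
rewrite !padic_absE //.
have [pp|np] := boolP (prime p); last by rewrite !padic_val0F // le_max lexx.
have E : x + y =
    (numq x * denq y + numq y * denq x)%:~R / (denq x * denq y)%:~R.
  rewrite -{1}[x]divq_num_den -{1}[y]divq_num_den rmorphD !rmorphM /=.
  by rewrite addf_div ?intr_eq0 ?denq_neq0.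
have s0 : numq x * denq y + numq y * denq x != 0.
  by apply: contraNneq xy0 => e; rewrite E e mul0r.
have H : Num.min (padic_val x) (padic_val y) <= padic_val (x + y).
  rewrite E padic_val_frac ?mulf_neq0 ?denq_neq0 //.
  have nd : numq x * denq y != 0 by rewrite mulf_neq0 ?numq_eq0 ?denq_neq0.
  have dn : numq y * denq x != 0 by rewrite mulf_neq0 ?numq_eq0 ?denq_neq0.
  have := logn_addz s0 nd dn; move: (logn p `|(_ + _)%R|) => k.
  rewrite ge_min geq_min /padic_val !abszM.
  rewrite !lognM ?absz_gt0 ?numq_eq0 ?denq_neq0 //.
  by case/orP => h; apply/orP; [left | right]; lia.
have p1 : 1 <= p%:R :> rat by rewrite ler1n prime_gt0.
by rewrite le_max; move: H; rewrite ge_min => /orP[] H;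
  apply/orP; [left|right]; apply: ler_weXz2l; rewrite // lerN2.
Qed.

Lemma padic_absB x y :
  padic_abs (x - y) <= Num.max (padic_abs x) (padic_abs y).
Proof. by rewrite -(padic_absN y) padic_absD. Qed.

Lemma padic_absBC x y : padic_abs (x - y) = padic_abs (y - x).
Proof. by rewrite -padic_absN opprB. Qed.

Lemma padic_abs_eq x y : padic_abs (x - y) < padic_abs x ->
  padic_abs y = padic_abs x.
Proof.
move=> h; apply/eqP; rewrite eq_le; apply/andP; split.
  have -> : y = x - (x - y) by ring.
  by rewrite (le_trans (padic_absB _ _)) // ge_max lexx ltW.
have: padic_abs x <= Num.max (padic_abs (x - y)) (padic_abs y).
  by rewrite -{1}(subrK y x) padic_absD.
by rewrite le_max leNgt h.
Qed.

Lemma padic_absV x : padic_abs x^-1 = (padic_abs x)^-1.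
Proof.
have [->|x0] := eqVneq x 0; first by rewrite padic_abs_0 !invr0 padic_abs_0.
apply: (mulfI (lt0r_neq0 (padic_abs_gt0 x0))).
rewrite -padic_absM divff // padic_abs_1 divff // lt0r_neq0 //.
exact: padic_abs_gt0.
Qed.

End PadicAbs.

(** The completion [padic p] of [rat] at [padic_abs p]: Cauchy sequences modulo
    null sequences. *)

Section Completion.
Variable p : nat.
Local Notation abs := (padic_abs p).

Definition is_cauchy (u : nat -> rat) : Prop :=
  forall e : rat, 0 < e -> exists N : nat, forall m n : nat,
    (N <= m)%N -> (N <= n)%N -> abs (u m - u n) < e.

Definition is_null (u : nat -> rat) : Prop :=
  forall e : rat, 0 < e -> exists N : nat, forall n : nat,
    (N <= n)%N -> abs (u n) < e.

Definition cauchy_pred : {pred (nat -> rat)} := fun u => `[< is_cauchy u >].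

Lemma cauchy_bounded u : is_cauchy u ->
  exists N, exists2 B, 0 < B & forall n, (N <= n)%N -> abs (u n) <= B.
Proof.
move=> /(_ 1 ltr01)[N uN]; exists N, (Num.max (abs (u N)) 1).
  by rewrite lt_max ltr01 orbT.
move=> n Nn; have -> : u n = u N + (u n - u N) by ring.
apply: le_trans (padic_absD _ _ _) _.
by rewrite ge_max !le_max lexx /= (ltW (uN _ _ _ _)) // orbT.
Qed.

Lemma cauchy_subring : subring_closed cauchy_pred.
Proof.
split=> [|u v /asboolP cu /asboolP cv|u v /asboolP cu /asboolP cv];
  apply/asboolP => e e0.
- by exists 0%N => m n _ _; rewrite /= subrr padic_abs_0.
- have [N uN] := cu e e0; have [M vM] := cv e e0.
  exists (maxn N M) => m n; rewrite !geq_max => /andP[Nm Mm] /andP[Nn Mn].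
  have -> : (u - v) m - (u - v) n = (u m - u n) - (v m - v n).
    by rewrite !fctE /=; ring.
  by rewrite (le_lt_trans (padic_absB _ _ _)) // gt_max uN ?vM.
- have [Nu [Bu Bu0 uB]] := cauchy_bounded cu.
  have [Nv [Bv Bv0 vB]] := cauchy_bounded cv.
  have [N uN] := cu (e / Bv) (divr_gt0 e0 Bv0).
  have [M vM] := cv (e / Bu) (divr_gt0 e0 Bu0).
  exists (maxn (maxn N M) (maxn Nu Nv)) => m n.
  rewrite !geq_max => /andP[/andP[? ?] /andP[? ?]] /andP[/andP[? ?] /andP[? ?]].
  have -> : (u * v) m - (u * v) n = u m * (v m - v n) + (u m - u n) * v n.
    by rewrite !fctE /=; ring.
  rewrite (le_lt_trans (padic_absD _ _ _)) // gt_max !padic_absM.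
  apply/andP; split.
    by apply: (@le_lt_trans _ _ (Bu * abs (v m - v n)));
      rewrite ?ler_wpM2r ?padic_abs_ge0 ?uB // mulrC -ltr_pdivlMr ?vM.
  by apply: (@le_lt_trans _ _ (abs (u m - u n) * Bv));
    rewrite ?ler_wpM2l ?padic_abs_ge0 ?vB // -ltr_pdivlMr ?uN.
Qed.

HB.instance Definition _ :=
  GRing.isSubringClosed.Build (nat -> rat) cauchy_pred cauchy_subring.

Record cauchy_seq := CauchySeq {
  cauchy_val :> nat -> rat;
  cauchy_valP : cauchy_val \in cauchy_pred }.

HB.instance Definition _ := [isSub for cauchy_val].
HB.instance Definition _ := [Choice of cauchy_seq by <:].
HB.instance Definition _ := [SubChoice_isSubComNzRing of cauchy_seq by <:].

Lemma is_cauchyP (u : cauchy_seq) : is_cauchy u.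
Proof. by apply/asboolP; exact: cauchy_valP. Qed.

Definition null_pred : {pred cauchy_seq} := fun u => `[< is_null u >].

Lemma null_ideal : idealr_closed null_pred.
Proof.
split.
- by apply/asboolP => e e0; exists 0%N => n _; rewrite padic_abs_0.
- apply/negP => /asboolP /(_ 1 ltr01)[N /(_ N (leqnn _))].
  by rewrite padic_abs_1 ltxx.
- move=> a u v /asboolP nu /asboolP nv; apply/asboolP => e e0.
  have [Na [B B0 aB]] := cauchy_bounded (is_cauchyP a).
  have [N uN] := nu (e / B) (divr_gt0 e0 B0); have [M vM] := nv e e0.
  exists (maxn Na (maxn N M)) => n; rewrite !geq_max => /and3P[? ? ?].
  have -> : (a * u + v) n = a n * u n + v n by [].
  rewrite (le_lt_trans (padic_absD _ _ _)) // gt_max vM // andbT padic_absM.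
  by apply: (@le_lt_trans _ _ (B * abs (u n)));
    rewrite ?ler_wpM2r ?padic_abs_ge0 ?aB // mulrC -ltr_pdivlMr ?uN.
Qed.

HB.instance Definition _ := isIdealr.Build cauchy_seq null_pred null_ideal.

Definition padic : Type := {ideal_quot null_pred}.
HB.instance Definition _ := GRing.ComNzRing.on padic.

Definition padic_class (u : cauchy_seq) : padic := \pi_{ideal_quot null_pred}%qT u.
Definition padic_repr (x : padic) : cauchy_seq := repr (x : {ideal_quot null_pred}).

Lemma padic_reprK x : padic_class (padic_repr x) = x.
Proof. exact: reprK. Qed.

Lemma padic_class_eq u v : padic_class u = padic_class v <-> is_null (u - v).
Proof.
split=> [/eqP|n]; first by rewrite -Quotient.idealrBE => /asboolP.
by apply/eqP; rewrite -Quotient.idealrBE; apply/asboolP.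
Qed.

Lemma padic_class_is_zmod : zmod_morphism padic_class.
Proof. exact: (raddfB (\pi_{ideal_quot null_pred}%qT)). Qed.
Lemma padic_class_is_monoid : monoid_morphism padic_class.
Proof.
by split; [exact: (rmorph1 (\pi_{ideal_quot null_pred}%qT))
          | exact: (rmorphM (\pi_{ideal_quot null_pred}%qT))].
Qed.
HB.instance Definition _ :=
  GRing.isZmodMorphism.Build cauchy_seq padic padic_class padic_class_is_zmod.
HB.instance Definition _ :=
  GRing.isMonoidMorphism.Build cauchy_seq padic padic_class padic_class_is_monoid.

Lemma padic_class_eq0 (u : cauchy_seq) : padic_class u = 0 <-> is_null u.
Proof. by rewrite -(rmorph0 padic_class) padic_class_eq subr0. Qed.

Lemma cauchy_not_null (u : nat -> rat) : is_cauchy u -> ~ is_null u ->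
  exists c N, 0 < c /\ forall n, (N <= n)%N -> abs (u n) = c.
Proof.
move=> cu /existsNP[e /not_implyP[e0 /forallNP nu]].
have [N uN] := cu e e0; have /existsNP[m /not_implyP[Nm /negP]] := nu N.
rewrite -leNgt => em; exists (abs (u m)), N.
split=> [|n Nn]; first exact: lt_le_trans em.
by apply: padic_abs_eq; rewrite (lt_le_trans _ em) // uN.
Qed.

Lemma padic_inv_ex (x : padic) : x != 0 -> exists y, y * x = 1.
Proof.
rewrite -(padic_reprK x); move: (padic_repr x) => u /eqP u0.
have [c [N [c0 uN]]] : exists c N, 0 < c /\
    forall n, (N <= n)%N -> abs (u n) = c.
  by apply: cauchy_not_null (is_cauchyP u) _ => /padic_class_eq0.
have un0 n : (N <= n)%N -> u n != 0.
  by move=> /uN un; apply: contraTneq c0 => u0'; rewrite -un u0' padic_abs_0.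
pose v n := (u n)^-1.
have cv : v \in cauchy_pred.
  apply/asboolP => e e0; have [M uM] := is_cauchyP u (mulr_gt0 e0 (mulr_gt0 c0 c0)).
  exists (maxn N M) => m n; rewrite !geq_max => /andP[Nm Mm] /andP[Nn Mn].
  have -> : v m - v n = (u n - u m) / (u m * u n).
    by rewrite /v; field; rewrite !un0.
  by rewrite padic_absM padic_absV padic_absM !uN // ltr_pdivrMr ?mulr_gt0 ?uM.
exists (padic_class (CauchySeq cv)).
rewrite -rmorphM -(rmorph1 padic_class); apply/padic_class_eq => e e0.
exists N => n Nn.
have -> : (CauchySeq cv * u - 1) n = (u n)^-1 * u n - 1 by [].
by rewrite mulVf ?un0 // subrr padic_abs_0.
Qed.

Definition padic_inv (x : padic) : padic :=
  if x == 0 then 0 else xget 0 [set y | y * x = 1]%classic.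

Lemma padic_mulVf (x : padic) : x != 0 -> padic_inv x * x = 1.
Proof.
move=> x0; rewrite /padic_inv (negPf x0).
exact: (xgetPex 0 (padic_inv_ex x0)).
Qed.

Lemma padic_inv0 : padic_inv 0 = 0. Proof. by rewrite /padic_inv eqxx. Qed.

HB.instance Definition _ :=
  GRing.ComNzRing_isField.Build padic padic_mulVf padic_inv0.

(** The absolute value of [padic p], as the limit of the absolute values along
    a Cauchy sequence.  This limit is rational, because the absolute values
    along a Cauchy sequence that is not null are eventually constant. *)

Definition is_limit (v : nat -> rat) (l : rat) : Prop :=
  forall e : rat, 0 < e -> exists N : nat, forall n : nat,
    (N <= n)%N -> `|v n - l| < e.

Definition padic_norm (x : padic) : rat :=
  xget 0 [set l | is_limit (fun n => abs (padic_repr x n)) l]%classic.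

Lemma is_limit_unique v l l' : is_limit v l -> is_limit v l' -> l = l'.
Proof.
move=> vl vl'; apply/eqP; rewrite -subr_eq0; apply: contraT => ll'.
have e0 : 0 < `|l - l'| / 2 by rewrite divr_gt0 ?normr_gt0.
have [N hN] := vl _ e0; have [M hM] := vl' _ e0.
have := hN (maxn N M) (leq_maxl _ _); have := hM (maxn N M) (leq_maxr _ _).
move: (v _) => t h1 h2.
have : `|l - l'| < `|l - l'| / 2 + `|l - l'| / 2.
  have {1}-> : l - l' = (t - l') - (t - l) by ring.
  by rewrite (le_lt_trans (ler_normB _ _)) // ltrD.
by rewrite -splitr ltxx.
Qed.

Lemma padic_abs_dist a b : `|abs a - abs b| <= abs (a - b).
Proof.
have mD (s t : rat) : 0 <= s -> 0 <= t -> Num.max s t <= s + t.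
  by move=> s0 t0; rewrite ge_max lerDl lerDr s0 t0.
have H (s t : rat) : abs s <= abs (s - t) + abs t.
  have := padic_absD p (s - t) t; rewrite subrK => /le_trans; apply.
  by rewrite mD ?padic_abs_ge0.
by rewrite ler_norml; have := H a b; have := H b a; rewrite (padic_absBC p b a); lra.
Qed.

Lemma cauchy_abs_limit (u : cauchy_seq) :
  exists l, is_limit (fun n => abs (u n)) l.
Proof.
have [nu|nu] := pselect (is_null u).
  exists 0 => e /nu[N uN]; exists N => n /uN.
  by rewrite subr0 ger0_norm ?padic_abs_ge0.
have [c [N [_ uN]]] := cauchy_not_null (is_cauchyP u) nu.
by exists c => e e0; exists N => n /uN ->; rewrite subrr normr0.
Qed.

Lemma padic_normP (x : padic) :
  is_limit (fun n => abs (padic_repr x n)) (padic_norm x).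
Proof. exact: (xgetPex 0 (cauchy_abs_limit _)). Qed.

Lemma padic_norm_class (u : cauchy_seq) l :
  is_limit (fun n => abs (u n)) l -> padic_norm (padic_class u) = l.
Proof.
move=> ul; apply: is_limit_unique ul => e e0.
have e20 : 0 < e / 2 by rewrite divr_gt0.
have /padic_class_eq nu := padic_reprK (padic_class u).
have [N hN] := padic_normP (padic_class u) e20; have [M hM] := nu _ e20.
exists (maxn N M) => n; rewrite geq_max => /andP[/hN h1 /hM h2].
have := padic_abs_dist (padic_repr (padic_class u) n) (u n).
move=> /le_lt_trans /(_ h2) h3.
by move: h1 h3; rewrite !ltr_norml; lra.
Qed.

Lemma padic_norm_eventually (x : padic) : x != 0 ->
  exists N, forall n, (N <= n)%N -> abs (padic_repr x n) = padic_norm x.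
Proof.
move=> x0; have [|c [N [_ h]]] := cauchy_not_null (is_cauchyP (padic_repr x)).
  by move=> /padic_class_eq0; rewrite padic_reprK => /eqP; rewrite (negPf x0).
suff -> : padic_norm x = c by exists N.
apply: is_limit_unique (padic_normP x) _ => e e0.
by exists N => n /h ->; rewrite subrr normr0.
Qed.

Lemma padic_norm0 : padic_norm 0 = 0.
Proof.
rewrite -(rmorph0 padic_class); apply: padic_norm_class => e e0.
by exists 0%N => n _; rewrite padic_abs_0 subrr normr0.
Qed.

Lemma padic_norm_gt0 x : x != 0 -> 0 < padic_norm x.
Proof.
move=> x0; have [|c [N [c0 h]]] := cauchy_not_null (is_cauchyP (padic_repr x)).
  by move=> /padic_class_eq0; rewrite padic_reprK => /eqP; rewrite (negPf x0).
have [M h'] := padic_norm_eventually x0.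
by rewrite -(h' (maxn N M)) ?leq_maxr // h ?leq_maxl.
Qed.

Lemma padic_norm_ge0 x : 0 <= padic_norm x.
Proof.
by have [->|/padic_norm_gt0/ltW//] := eqVneq x 0; rewrite padic_norm0.
Qed.

Lemma padic_normM x y : padic_norm (x * y) = padic_norm x * padic_norm y.
Proof.
have [->|x0] := eqVneq x 0; first by rewrite mul0r padic_norm0 mul0r.
have [->|y0] := eqVneq y 0; first by rewrite mulr0 padic_norm0 mulr0.
have [N hN] := padic_norm_eventually x0; have [M hM] := padic_norm_eventually y0.
rewrite -{1}(padic_reprK x) -{1}(padic_reprK y) -rmorphM.
apply: padic_norm_class => e e0; exists (maxn N M) => n.
rewrite geq_max => /andP[/hN <- /hM <-].
have -> : (padic_repr x * padic_repr y) n = padic_repr x n * padic_repr y n by [].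
by rewrite padic_absM subrr normr0.
Qed.

Lemma padic_normD x y :
  padic_norm (x + y) <= Num.max (padic_norm x) (padic_norm y).
Proof.
have [->|x0] := eqVneq x 0; first by rewrite add0r le_max lexx orbT.
have [->|y0] := eqVneq y 0; first by rewrite addr0 le_max lexx.
have [N hN] := padic_norm_eventually x0; have [M hM] := padic_norm_eventually y0.
have [l hl] := cauchy_abs_limit (padic_repr x + padic_repr y).
rewrite -{1}(padic_reprK x) -{1}(padic_reprK y) -rmorphD (padic_norm_class hl).
apply/ler_addgt0Pr => e e0; have [K hK] := hl e e0.
pose n := maxn K (maxn N M).
have Kn : (K <= n)%N by rewrite leq_maxl.
have Nn : (N <= n)%N by rewrite !leq_max leqnn orbT.
have Mn : (M <= n)%N by rewrite !leq_max leqnn !orbT.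
have := hK _ Kn; rewrite ltr_distlC => /andP[_ /ltW/le_trans->//].
rewrite lerD2r -(hN n) // -(hM n) //; exact: padic_absD.
Qed.

Lemma const_cauchy (q : rat) : (fun=> q) \in cauchy_pred.
Proof. by apply/asboolP => e e0; exists 0%N => m n _ _; rewrite subrr padic_abs_0. Qed.

Definition padic_of_rat (q : rat) : padic :=
  padic_class (CauchySeq (const_cauchy q)).

Lemma padic_of_rat_is_zmod : zmod_morphism padic_of_rat.
Proof.
move=> a b; rewrite /padic_of_rat -rmorphB.
by congr padic_class; apply: val_inj.
Qed.

Lemma padic_of_rat_is_monoid : monoid_morphism padic_of_rat.
Proof.
split=> [|a b]; rewrite /padic_of_rat -?(rmorph1 padic_class) -?rmorphM;
by congr padic_class; apply: val_inj.
Qed.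

HB.instance Definition _ :=
  GRing.isZmodMorphism.Build rat padic padic_of_rat padic_of_rat_is_zmod.
HB.instance Definition _ :=
  GRing.isMonoidMorphism.Build rat padic padic_of_rat padic_of_rat_is_monoid.

Lemma padic_norm_rat (q : rat) : padic_norm (padic_of_rat q) = abs q.
Proof.
apply: padic_norm_class => e e0.
by exists 0%N => n _; rewrite subrr normr0.
Qed.

Lemma padic_rat_dense (x : padic) (e : rat) : 0 < e ->
  exists q : rat, padic_norm (x - padic_of_rat q) < e.
Proof.
move=> e0; have e20 : 0 < e / 2 by rewrite divr_gt0.
have [N uN] := is_cauchyP (padic_repr x) e20.
exists (padic_repr x N); rewrite -{1}(padic_reprK x) -rmorphB.
set w := (_ - _); have [l hl] := cauchy_abs_limit w; rewrite (padic_norm_class hl).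
have [M hM] := hl _ e20.
have := hM (maxn N M) (leq_maxr _ _); rewrite ltr_distlC => /andP[_ h].
have := uN (maxn N M) N (leq_maxl _ _) (leqnn _).
by rewrite -[_ - _]/(w _) => h'; move: h h'; lra.
Qed.

End Completion.

Arguments padic_of_rat {p} q.

Section Ruban.
Variable p : nat.

Definition Zinv : set rat :=
  [set a | exists (z : int) (k : nat), a = z%:~R / p%:R ^+ k]%classic.

Definition is_padic_floor (x : padic p) (a : rat) : Prop :=
  [/\ Zinv a, 0 <= a < p%:R & padic_norm (x - padic_of_rat a) < 1].

Definition padic_floor (x : padic p) : rat := xget 0 (is_padic_floor x).

Lemma padic_val_int (z : int) : padic_val p z%:~R = (logn p `|z|)%:Z.
Proof. by rewrite /padic_val numq_int denq_int logn1 subr0. Qed.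

Lemma padic_val_nat (n : nat) : padic_val p n%:R = (logn p n)%:Z.
Proof. exact: (padic_val_int n). Qed.

Lemma padic_abs_int_le1 (z : int) : padic_abs p z%:~R <= 1.
Proof.
have [->|z0] := eqVneq z 0; first by rewrite padic_abs_0.
rewrite padic_absE ?intr_eq0 //.
have [pp|np] := boolP (prime p); last by rewrite padic_val0F.
rewrite -(expr0z (p%:R : rat)) ler_weXz2l ?ler1n ?prime_gt0 //.
by rewrite padic_val_int; lia.
Qed.

Lemma padic_abs_intX (z : int) k : prime p -> z != 0 ->
  padic_abs p z%:~R < padic_abs p (p%:R ^+ k) -> (p ^ k.+1 %| `|z|)%N.
Proof.
move=> pp z0; have p1 : 1 < p%:R :> rat by rewrite ltr1n prime_gt1.
have p0 : p%:R != 0 :> rat by rewrite pnatr_eq0 -lt0n prime_gt0.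
rewrite !padic_absE ?expf_neq0 ?intr_eq0 // ltr_eXz2l // ltrN2.
rewrite -natrX padic_val_int padic_val_nat pfactorK // => h.
by rewrite pfactor_dvdn // absz_gt0.
Qed.

Lemma padic_abs_p : prime p -> padic_abs p p%:R = p%:R^-1.
Proof.
move=> pp; have p0 : p%:R != 0 :> rat by rewrite pnatr_eq0 -lt0n prime_gt0.
by rewrite padic_absE // padic_val_nat -[logn p p]/(logn p (p ^ 1)) pfactorK.
Qed.

Lemma padic_floor_unique (x : padic p) a b : prime p ->
  is_padic_floor x a -> is_padic_floor x b -> a = b.
Proof.
move=> pp [[z [k az]] a_in xa] [[w [l bw]] b_in xb].
have p0 : p%:R != 0 :> rat by rewrite pnatr_eq0 -lt0n prime_gt0.
have dab : padic_abs p (a - b) < 1.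
  rewrite -padic_norm_rat rmorphB /=.
  have -> : padic_of_rat a - padic_of_rat b = (x - padic_of_rat b) + - 1 * (x - padic_of_rat a) by ring.
  rewrite (le_lt_trans (padic_normD _ _)) // gt_max xb padic_normM.
  by rewrite -(rmorphN1 (@padic_of_rat p)) padic_norm_rat padic_absN padic_abs_1 mul1r.
pose s := z * p%:Z ^+ l - w * p%:Z ^+ k.
have E : a - b = s%:~R / p%:R ^+ (k + l).
  rewrite az bw /s rmorphB !rmorphM /= !rmorphXn /= exprD.
  by field; rewrite !expf_neq0.
have [s0|s0] := eqVneq s 0.
  by apply/eqP; rewrite -subr_eq0 E s0 mul0r.
have /dvdnP[t ht] : (p ^ (k + l).+1 %| `|s|)%N.
  apply: padic_abs_intX => //; move: dab.
  rewrite E padic_absM padic_absV ltr_pdivrMr ?mul1r //.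
  by rewrite padic_abs_gt0 ?expf_neq0.
have t0 : (0 < t)%N.
  rewrite lt0n; apply: contra_neqN s0 => /eqP t0.
  by apply/eqP; rewrite -absz_eq0 ht t0.
have : p%:R <= `|a - b|.
  rewrite E normrM normfV normrX normr_nat -intr_norm -abszE ht.
  have -> : (t * p ^ (k + l).+1)%N%:~R = t%:R * p%:R * p%:R ^+ (k + l) :> rat.
    by rewrite -mulrA -exprS -natrX -natrM.
  rewrite mulfK ?expf_neq0 //.
  by rewrite ler_peMl ?ler0n ?ler1n.
by case/andP: a_in => ? ?; case/andP: b_in => ? ?; rewrite ler_normr => /orP[]; lra.
Qed.

Lemma is_padic_floor_ex (x : padic p) : prime p -> exists a, is_padic_floor x a.
Proof.
move=> pp; have p0 : p%:R != 0 :> rat by rewrite pnatr_eq0 -lt0n prime_gt0.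
have [q xq] := padic_rat_dense x ltr01.
suff [a [aZ a_in qa]] : exists a,
    [/\ Zinv a, 0 <= a < p%:R & padic_abs p (q - a) < 1].
  exists a; split=> //.
  have -> : x - padic_of_rat a = (x - padic_of_rat q) + padic_of_rat (q - a) by rewrite rmorphB /=; ring.
  by rewrite (le_lt_trans (padic_normD _ _)) // gt_max xq padic_norm_rat.
have d0 : (0 < `|denq q|)%N by rewrite absz_gt0 denq_neq0.
have [m pm dE] := pfactor_coprime pp d0.
set k := logn p _ in dE.
have m0 : m%:R != 0 :> rat.
  by rewrite pnatr_eq0; apply: contraTneq d0 => m0; rewrite dE m0.
have [[u v] /= uv] : exists uv : int * int,
    uv.1 * m%:Z + uv.2 * (p ^ k.+1)%N%:Z = 1.
  have /coprimezP : coprimez m%:Z (p ^ k.+1)%N%:Z.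
    by rewrite coprimezE /= coprimeXr // coprime_sym.
  by [].
pose P : int := (p ^ k.+1)%N%:Z.
have P0 : 0 < P by rewrite /P ltz_nat expn_gt0 prime_gt0.
pose z := (u * numq q %% P)%Z.
have [w zE] : exists w, z = u * numq q - w * P.
  exists (u * numq q %/ P)%Z; have := divz_eq (u * numq q) P.
  by rewrite -/z => /eqP; rewrite addrC -subr_eq => /eqP.
exists (z%:~R / p%:R ^+ k); split; first by exists z, k.
  rewrite divr_ge0 ?exprn_ge0 ?ler0n ?ler0z ?modz_ge0 ?lt0r_neq0 //=.
  rewrite ltr_pdivrMr ?exprn_gt0 ?ltr0n ?prime_gt0 // -exprS -natrX.
  by rewrite -[_%:R]/(P%:~R) ltr_int ltz_pmod.
have qE : q = (numq q)%:~R / (m%:R * p%:R ^+ k).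
  by rewrite -{1}[q]divq_num_den -[denq q]gez0_abs ?denq_ge0 // dE -natrX -natrM.
pose t := numq q * v + w * m%:Z.
have H : numq q - z * m%:Z = P * t.
  by rewrite zE /t /P -{1}[numq q]mulr1 -uv; ring.
have -> : q - z%:~R / p%:R ^+ k = p%:R * t%:~R / m%:R.
  rewrite {1}qE; have H' := congr1 (fun i : int => i%:~R : rat) H.
  rewrite rmorphB !rmorphM /= /P -[_%:~R in RHS]/((p ^ k.+1)%:R) natrX exprS in H'.
  have -> : (numq q)%:~R = p%:R * p%:R ^+ k * t%:~R + z%:~R * m%:R :> rat.
    by rewrite -H' subrK.
  have := expf_neq0 k p0; move: (p%:R ^+ k) => y y0.
  by field; rewrite m0 y0.
have m1 : padic_abs p m%:R = 1.
  by rewrite padic_absE // padic_val_nat logn_coprime.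
rewrite !padic_absM padic_absV m1 invr1 mulr1 padic_abs_p //.
rewrite mulrC ltr_pdivrMr ?mul1r ?ltr0n ?prime_gt0 //.
by rewrite (le_lt_trans (padic_abs_int_le1 _)) // ltr1n prime_gt1.
Qed.

Lemma padic_floorP (x : padic p) : prime p -> is_padic_floor x (padic_floor x).
Proof. by move=> pp; exact: (xgetPex 0 (is_padic_floor_ex x pp)). Qed.

(** Complete quotients and partial quotients of the Ruban expansion; [None]
    means that the procedure has already stopped. *)

Fixpoint ruban_complete (x : padic p) (n : nat) : option (padic p) :=
  if n is n'.+1 then
    obind (fun y => let r := y - padic_of_rat (padic_floor y) in
                    if r == 0 then None else Some r^-1)
          (ruban_complete x n')
  else Some x.

Definition ruban (x : padic p) (n : nat) : option rat :=
  omap padic_floor (ruban_complete x n).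

Definition ruban_periodic (x : padic p) : Prop :=
  (forall n, ruban x n <> None) /\
  exists N k : nat, (0 < k)%N /\
    forall n, (N <= n)%N -> ruban x (n + k) = ruban x n.

End Ruban.

(* Main.v *)
Require Import Defs.
From mathcomp Require Import all_boot all_order all_algebra.
From mathcomp Require Import ring lra zify.
From mathcomp Require Import boolp classical_sets functions cardinality.

(** Let [x] be a root of [A X^2 + B X + C] in Q_p, with [A > 0] (change all signs
    otherwise), and let [c n] and [a n] be its complete and partial quotients.

    The theorem comes from the signs of rational coefficients.  If
    [c n] is a root of a quadratic polynomial [g] with positive coefficients and
    [c n = a n + 1 / c n.+1] with [a n >= 0], then [c n.+1] is a root of
    [Y^2 g (a n + 1 / Y)], whose coefficients [g (a n)], [g' (a n)] and the
    leading coefficient of [g] are again positive ([pos_quadratic_root_step]).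
    So positivity, once reached, persists along the whole expansion.
    Periodicity contradicts it: if [c N = c (N + k)] with [N > 0] then [c N] is fixed by a
    product of matrices with rows [a n, 1] and [1, 0], that is, it is a root of
    [R X^2 + (S - P) X - Q] with [R] and [Q] positive.  A polynomial with this
    sign pattern is not proportional to one with positive coefficients, so
    eliminating the square leaves a nontrivial linear equation and [c N] is
    rational ([periodic_pos_root_rational]).  Then [x] is rational too, which
    irreducibility forbids.  (In terms of real conjugates: the conjugates of
    [c N] are both negative, or not real, by the first polynomial, while the
    second one has a positive root.)

    Positivity is reached after a single step if [p] is large.  As [p] does not
    divide [A], [x] is a p-adic integer, so [a 0] is an ordinary nonnegative
    integer [z] and [p] divides the nonzero integer [A z^2 + B z + C]
    ([integral_floor_dvd]).  A large [p] therefore forces [z] to be large, and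
    then [A z^2 + B z + C], [2 A z + B] and [A] are positive: these are the
    coefficients of a quadratic polynomial with root [c 1].

    That periodic partial quotients give periodic complete quotients is the
    uniqueness of the number with a given infinite expansion
    ([ruban_unique]). *)

Set Implicit Arguments.
Unset Strict Implicit.
Unset Printing Implicit Defensive.

Import Order.TTheory GRing.Theory Num.Theory.
Local Open Scope ring_scope.
Local Open Scope classical_set_scope.

(** * Quadratic equations along a continued fraction *)

Definition pos_quadratic_root (K : fieldType) (i : {rmorphism rat -> K})
    (x : K) : Prop :=
  exists u v w : rat,
    [/\ 0 < u, 0 < v, 0 < w & i u * x ^+ 2 + i v * x + i w = 0].

(** The new coefficients are [g a], [g' a] and the leading coefficient of
    [g = u X^2 + v X + w]: this is [Y^2 g (a + 1 / Y)], by Taylor expansion. *)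
Lemma quadratic_step (K : fieldType) (i : {rmorphism rat -> K})
    (u v w a : rat) (x y : K) :
  y != 0 -> x = i a + y^-1 -> i u * x ^+ 2 + i v * x + i w = 0 ->
  i (u * a ^+ 2 + v * a + w) * y ^+ 2 + i (2%:R * u * a + v) * y + i u = 0.
Proof.
move=> y0 -> e; rewrite -[RHS](mul0r (y ^+ 2)) -e.
by rewrite !(rmorphD, rmorphXn, rmorphM, rmorph_nat) /=; field.
Qed.

Lemma pos_quadratic_root_step (K : fieldType) (i : {rmorphism rat -> K})
    (a : rat) (x y : K) :
  0 <= a -> y != 0 -> x = i a + y^-1 ->
  pos_quadratic_root i x -> pos_quadratic_root i y.
Proof.
move=> a0 y0 xy [u [v [w [u0 v0 w0 /(quadratic_step y0 xy) e]]]].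
exists (u * a ^+ 2 + v * a + w), (2%:R * u * a + v), u; split=> //.
  by rewrite ltr_wpDl // addr_ge0 // mulr_ge0 ?exprn_ge0 // ltW.
by rewrite ltr_wpDl // !mulr_ge0 // ltW.
Qed.

Lemma cf_step_subr (K : fieldType) (t y z : K) : y != 0 -> z != 0 ->
  (t + y^-1) - (t + z^-1) = - (y - z) * y^-1 * z^-1.
Proof. by move=> y0 z0; field; apply/andP. Qed.

(** [P, Q; R, S] is the product of the matrices [a n, 1; 1, 0] for [n <= k]; its
    entries are positive, except that [S = 0] for [k = 0]. *)
Lemma cf_tail_moebius (K : fieldType) (i : {rmorphism rat -> K})
    (c : nat -> K) (a : nat -> rat) (k : nat) :
  (forall n, c n.+1 != 0) -> (forall n, c n = i (a n) + (c n.+1)^-1) ->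
  (forall n, 0 < a n) ->
  exists P Q R S : rat, [/\ 0 < P, 0 < Q, 0 < R, 0 <= S &
    c 0%N * (i R * c k.+1 + i S) = i P * c k.+1 + i Q].
Proof.
move=> c0 cE a0; elim: k => [|k [P [Q [R [S [P0 Q0 R0 S0 e]]]]]].
  exists (a 0%N), 1, 1, 0; split=> //.
  by rewrite cE rmorph1 rmorph0; field; exact: c0.
exists (P * a k.+1 + Q), P, (R * a k.+1 + S), R; split=> //.
- by rewrite addr_gt0 // mulr_gt0.
- by rewrite ltr_pwDl // mulr_gt0.
- exact: ltW.
have y0 := c0 k.+1; move: e; rewrite (cE k.+1) => e.
rewrite !rmorphD !rmorphM /=.
transitivity ((c 0%N * (i R * (i (a k.+1) + (c k.+2)^-1) + i S)) * c k.+2).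
  by field.
by rewrite e; field.
Qed.

(** With [x := c 0] and [P, Q, R, S] the matrix of a period,
    [R x^2 + (S - P) x - Q = 0].  Subtracting [R] times the positive equation
    from [u] times this one kills the square and leaves [d x = t] with
    [t = u Q + w R > 0]; hence [d != 0] and [x = t / d]. *)
Lemma periodic_pos_root_rational (K : fieldType) (i : {rmorphism rat -> K})
    (c : nat -> K) (a : nat -> rat) (k : nat) :
  (forall n, c n.+1 != 0) -> (forall n, c n = i (a n) + (c n.+1)^-1) ->
  (forall n, 0 < a n) -> c k.+1 = c 0%N -> pos_quadratic_root i (c 0%N) ->
  exists q, c 0%N = i q.
Proof.
move=> c0 cE a0 per [u [v [w [u0 v0 w0 e]]]].
have [P [Q [R [S [P0 Q0 R0 S0]]]]] := cf_tail_moebius k c0 cE a0.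
rewrite per; move: (c 0%N) e => x e h.
pose d := u * (S - P) - v * R; pose t := u * Q + w * R.
have t0 : 0 < t by rewrite addr_gt0 // mulr_gt0.
have dx : i d * x = i t.
  apply/eqP; rewrite -subr_eq0; apply/eqP.
  transitivity (i u * (x * (i R * x + i S) - (i P * x + i Q))
      - i R * (i u * x ^+ 2 + i v * x + i w)).
    by rewrite /d /t !(rmorphB, rmorphD, rmorphM) /=; ring.
  by rewrite e h subrr !mulr0 subrr.
have d0 : d != 0.
  apply: contraTneq t0 => d0; move: dx; rewrite d0 rmorph0 mul0r => /esym/eqP.
  by rewrite fmorph_eq0 => /eqP ->; rewrite ltxx.
exists (t / d); rewrite fmorph_div -dx mulrAC divff ?mul1r // fmorph_eq0 //.
Qed.

Lemma rational_of_tail (K : fieldType) (i : {rmorphism rat -> K})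
    (c : nat -> K) (a : nat -> rat) (n : nat) :
  (forall n, c n = i (a n) + (c n.+1)^-1) ->
  (exists q, c n = i q) -> exists q, c 0%N = i q.
Proof.
move=> cE; elim: n => // n IH [q cq]; apply: IH.
by exists (a n + q^-1); rewrite cE cq rmorphD fmorphV.
Qed.

(** * The p-adic norm *)

Lemma padic_normB p (x y : padic p) :
  padic_norm (x - y) <= Num.max (padic_norm x) (padic_norm y).
Proof.
have -> : x - y = x + padic_of_rat (-1) * y by rewrite rmorphN1 mulN1r.
apply: le_trans (padic_normD _ _) _.
by rewrite padic_normM padic_norm_rat padic_absN padic_abs_1 mul1r.
Qed.

Lemma padic_normV p (x : padic p) : padic_norm x^-1 = (padic_norm x)^-1.
Proof.
have [->|x0] := eqVneq x 0; first by rewrite invr0 padic_norm0 invr0.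
have nx := lt0r_neq0 (padic_norm_gt0 x0).
apply: (mulfI nx); rewrite -padic_normM !divff //.
by rewrite -(rmorph1 padic_of_rat) padic_norm_rat padic_abs_1.
Qed.

Lemma padic_norm_int p (z : int) :
  padic_norm (z%:~R : padic p) = padic_abs p z%:~R.
Proof. by rewrite -(rmorph_int padic_of_rat) padic_norm_rat. Qed.

(** The value group is discrete; the gap above 1 gives a uniform contraction
    factor in [ruban_unique]. *)
Lemma padic_abs_gt1_ge2 p (q : rat) : prime p ->
  1 < padic_abs p q -> 2%:R <= padic_abs p q.
Proof.
move=> pp; have [->|q0] := eqVneq q 0; first by rewrite padic_abs_0.
have p1 : 1 < p%:R :> rat by rewrite ltr1n prime_gt1.
rewrite padic_absE // -{1}(expr0z (p%:R : rat)) ltr_eXz2l // => h.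
apply: (@le_trans _ _ (p%:R ^ 1)); first by rewrite expr1z ler_nat prime_gt1.
by rewrite ler_eXz2l //; lia.
Qed.

(** * Infinite Ruban expansions *)

(** The complete and partial quotients of an infinite expansion as a relation
    between two total sequences, which makes it stable under shifts and lets
    one sequence [a] be compared with two sequences [c]. *)
Definition is_ruban p (c : nat -> padic p) (a : nat -> rat) : Prop :=
  [/\ forall n, c n.+1 != 0,
      forall n, c n = padic_of_rat (a n) + (c n.+1)^-1,
      forall n, padic_norm (c n - padic_of_rat (a n)) < 1 &
      forall n, 0 <= a n].

Lemma ruban_infinite p (x : padic p) : prime p ->
  (forall n, ruban x n <> None) ->
  exists c a, [/\ c 0%N = x, is_ruban c a, Zinv p (a 0%N) &
    forall n, ruban x n = Some (a n)].
Proof.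
move=> pp inf.
pose c n := odflt 0 (ruban_complete x n).
have cS n : ruban_complete x n = Some (c n).
  by have := inf n; rewrite /ruban /c; case: (ruban_complete x n).
pose a n := padic_floor (c n).
have fl n : is_padic_floor (c n) (a n) by exact: padic_floorP.
have st n : c n - padic_of_rat (a n) != 0 /\
    c n.+1 = (c n - padic_of_rat (a n))^-1.
  have := cS n.+1; rewrite /= cS /= -/(a n).
  by case: eqVneq => // ? [].
exists c, a; split=> //; [|by have [] := fl 0%N|by move=> n; rewrite /ruban cS].
split=> n.
- by have [? ->] := st n; rewrite invr_eq0.
- by have [? ->] := st n; rewrite invrK addrC subrK.
- by have [] := fl n.
- by have [_ /andP[]] := fl n.
Qed.

Lemma ruban_norm_gt1 p (c : nat -> padic p) a n :
  is_ruban c a -> 1 < padic_norm (c n.+1).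
Proof.
move=> [c0 cE fl _]; have := fl n.
rewrite {1}cE addrAC subrr add0r padic_normV => h.
by rewrite -[X in _ < X]invrK invf_gt1 // invr_gt0 padic_norm_gt0.
Qed.

(** Since [c n.+1] has norm greater than 1 and differs from [a n.+1] by less than
    1, both have the same norm; the norm of a rational number is at least 2 as
    soon as it exceeds 1, and [a n.+1] is not zero. *)
Lemma ruban_norm_ge2 p (c : nat -> padic p) a n : prime p ->
  is_ruban c a -> 2%:R <= padic_norm (c n.+1) /\ 0 < a n.+1.
Proof.
move=> pp rc; have c1 := ruban_norm_gt1 n rc; have [_ _ fl a0] := rc.
have := fl n.+1; set r := _ - _ => r1.
have aE : padic_of_rat (a n.+1) = c n.+1 - r by rewrite /r; ring.
have a1 : 1 < padic_abs p (a n.+1).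
  have := padic_normD (padic_of_rat (a n.+1)) r.
  rewrite {1}aE subrK padic_norm_rat le_max => /orP[/(lt_le_trans c1)//|].
  by move=> /(lt_le_trans c1)/lt_trans/(_ r1); rewrite ltxx.
split.
  have := padic_abs_gt1_ge2 pp a1; rewrite -padic_norm_rat aE => a2.
  have := le_trans a2 (padic_normB _ _); rewrite le_max => /orP[//|].
  by move=> /le_lt_trans/(_ r1).
rewrite lt_def a0 andbT; apply: contraTneq a1 => ->.
by rewrite padic_abs_0.
Qed.

Lemma is_ruban_shift p (c : nat -> padic p) a N :
  is_ruban c a -> is_ruban (fun n => c (N + n)%N) (fun n => a (N + n)%N).
Proof.
by move=> [c0 cE fl a0]; split=> n; rewrite ?addnS //; apply: cE.
Qed.

(** Inversion contracts distances where norms are at least 2: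
    [c n - d n] is [(d n.+1 - c n.+1) / (c n.+1 * d n.+1)], while all distances
    [c n - d n] have norm at most 1 because [c n] and [d n] have the same floor.
    Going back from index [m] gives [2^-m] for every [m]. *)
Lemma ruban_unique p (c d : nat -> padic p) a : prime p ->
  is_ruban c a -> is_ruban d a -> c 0%N = d 0%N.
Proof.
move=> pp rc rd; have [c0 cE cf _] := rc; have [d0 dE df _] := rd.
have close m n : padic_norm (c n - d n) <= 2%:R ^- m.
  elim: m n => [|m IH] n.
    have -> : c n - d n =
        (c n - padic_of_rat (a n)) - (d n - padic_of_rat (a n)) by ring.
    by rewrite invr1 (le_trans (padic_normB _ _)) // ge_max !ltW.
  have -> : c n - d n = - (c n.+1 - d n.+1) * (c n.+1)^-1 * (d n.+1)^-1.
    by rewrite (cE n) (dE n) cf_step_subr.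
  have [c2 _] := ruban_norm_ge2 n pp rc; have [d2 _] := ruban_norm_ge2 n pp rd.
  rewrite opprB !padic_normM !padic_normV exprS invfM mulrC.
  have h : padic_norm (d n.+1 - c n.+1) <= 2%:R ^- m.
    have := padic_normB 0 (c n.+1 - d n.+1).
    rewrite sub0r opprB padic_norm0 => /le_trans; apply.
    by rewrite ge_max IH andbT invr_ge0 exprn_ge0.
  have i2 (t : rat) : 2%:R <= t -> 0 <= t^-1 <= 2%:R^-1.
    by move=> t2; rewrite invr_ge0 lef_pV2 ?posrE ?t2 ?andbT; lra.
  have /andP[ci0 ci] := i2 _ c2; have /andP[di0 di] := i2 _ d2.
  apply: ler_pM => //; first by rewrite mulr_ge0 ?padic_norm_ge0.
  rewrite -[leRHS]mulr1; apply: ler_pM => //; first exact: padic_norm_ge0.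
  by apply: le_trans ci _; rewrite invf_le1.
apply/eqP; rewrite -subr_eq0; apply: contraT => /padic_norm_gt0 e0.
set e := padic_norm _ in e0.
pose m := Num.bound e^-1.
have := upper_nthrootP (leqnn m); have := close m 0%N; rewrite -/e.
rewrite -[leLHS]invrK lef_pV2 ?posrE ?invr_gt0 ?exprn_gt0 // => h.
by move=> /(le_lt_trans h); rewrite ltxx.
Qed.

(** The polynomial equation is propagated to a complete quotient in the periodic
    part, which is rational by [periodic_pos_root_rational]; then one goes back
    to [c 0]. *)
Lemma ruban_periodic_pos_root_rational p (c : nat -> padic p) a N k :
  prime p -> is_ruban c a -> (0 < k)%N ->
  (forall n, (N <= n)%N -> a (n + k)%N = a n) ->
  pos_quadratic_root padic_of_rat (c 1%N) -> exists q, c 0%N = padic_of_rat q.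
Proof.
move=> pp rc; case: k => // k _ per pos1; have [c0 cE _ a0] := rc.
have posn n : pos_quadratic_root padic_of_rat (c n.+1).
  elim: n => // n; exact: pos_quadratic_root_step (a0 n.+1) (c0 n.+1) (cE n.+1).
(* The tail starts at N.+1 rather than N because a n is known to be positive
   only for n > 0. *)
have rN := is_ruban_shift N.+1 rc.
have rNk := is_ruban_shift k.+1 rN.
have aE : (fun n => a (N.+1 + (k.+1 + n))%N) = (fun n => a (N.+1 + n)%N).
  by apply/funext => n; rewrite (addnC k.+1) addnA per // addSn ltnW // ltnS leq_addr.
rewrite aE in rNk; have ck := ruban_unique pp rNk rN.
apply: (rational_of_tail (n := N.+1) cE).
have [cN0 cNE _ _] := rN.
have := periodic_pos_root_rational (k := k) cN0 cNE; rewrite !addn0 in ck *.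
apply=> // n; rewrite addSn; exact: (ruban_norm_ge2 _ pp rc).2.
Qed.

(** * The first partial quotient *)

Lemma padic_abs_coprime p (n : nat) : (0 < n < p)%N -> padic_abs p n%:R = 1.
Proof.
move=> /andP[n0 np]; rewrite padic_absE ?pnatr_eq0 -?lt0n // padic_val_nat.
suff -> : logn p n = 0%N by [].
by apply/eqP; rewrite -leqn0 leqNgt logn_gt0 mem_primes n0 /= gtnNdvd ?andbF.
Qed.

(** If the norm of [x] exceeded 1, the term [A x^2] would dominate the two
    others. *)
Lemma quadratic_root_norm_le1 p (A B C : int) (x : padic p) :
  padic_abs p A%:~R = 1 ->
  A%:~R * x ^+ 2 + B%:~R * x + C%:~R = 0 -> padic_norm x <= 1.
Proof.
move=> A1 e; rewrite leNgt; apply/negP => x1.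
have : padic_norm (A%:~R * x ^+ 2) <= padic_norm x.
  have -> : A%:~R * x ^+ 2 = 0 - (B%:~R * x + C%:~R) by rewrite -e; ring.
  apply: le_trans (padic_normB _ _) _; rewrite padic_norm0 ge_max padic_norm_ge0.
  apply: le_trans (padic_normD _ _) _; rewrite padic_normM !padic_norm_int.
  rewrite ge_max ler_piMl ?padic_abs_int_le1 ?padic_norm_ge0 //=.
  exact: le_trans (padic_abs_int_le1 _ _) (ltW x1).
rewrite expr2 !padic_normM padic_norm_int A1 mul1r ger_pMl.
  by rewrite leNgt x1.
exact: lt_trans x1.
Qed.

(** In [z / p^k] the whole power [p^k] divides [z], since the norm is at most 1. *)
Lemma Zinv_integral p a : prime p -> Zinv p a -> padic_abs p a <= 1 ->
  exists z : int, a = z%:~R.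
Proof.
move=> pp [z [k ->]] a1.
have p0 : p%:R != 0 :> rat by rewrite pnatr_eq0 -lt0n prime_gt0.
have [->|z0] := eqVneq z 0; first by exists 0; rewrite mul0r.
case: k a1 => [|k] a1; first by exists z; rewrite divr1.
have : (p ^ k.+1 %| `|z|)%N.
  apply: padic_abs_intX => //; move: a1.
  rewrite padic_absM padic_absV ler_pdivrMr ?padic_abs_gt0 ?expf_neq0 // mul1r.
  move=> /le_lt_trans; apply; rewrite exprS padic_absM padic_abs_p //.
  rewrite gtr_pMl ?padic_abs_gt0 ?expf_neq0 // invf_lt1 ?ltr0n ?prime_gt0 //.
  by rewrite ltr1n prime_gt1.
rewrite -[(_ %| _)%N]/(dvdz (p ^ k.+1)%:Z z) => /dvdzP[w ->].
by exists w; rewrite rmorphM /= -pmulrn natrX mulfK ?expf_neq0.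
Qed.

(** For [f = A X^2 + B X + C], [f z = f z - f x] is [x - z] times a p-adic
    integer, so the integer [f z] has norm less than 1. *)
Lemma integral_floor_dvd p (A B C : int) (x : padic p) (a : rat) :
  prime p -> padic_abs p A%:~R = 1 ->
  A%:~R * x ^+ 2 + B%:~R * x + C%:~R = 0 -> Zinv p a ->
  padic_norm (x - padic_of_rat a) < 1 ->
  exists2 z : int, a = z%:~R & (p%:Z %| A * z ^+ 2 + B * z + C)%Z.
Proof.
move=> pp A1 e aZ xa; have x1 := quadratic_root_norm_le1 A1 e.
have a1 : padic_abs p a <= 1.
  rewrite -padic_norm_rat.
  have -> : padic_of_rat a = x - (x - padic_of_rat a) by ring.
  by apply: le_trans (padic_normB _ _) _; rewrite ge_max x1 ltW.
have [z az] := Zinv_integral pp aZ a1; exists z => //.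
set s := A * _ + _ + _; have [->|s0] := eqVneq s 0; first exact: dvdz0.
(* The exponent 1 matches the form of padic_abs_intX, used here with k = 0. *)
suff : (p ^ 1 %| `|s|)%N by [].
apply: padic_abs_intX => //; rewrite expr0 padic_abs_1 -padic_norm_int.
have zE : z%:~R = padic_of_rat a :> padic p by rewrite az rmorph_int.
have -> : s%:~R = (x - padic_of_rat a) *
    (0 - (A%:~R * (x + padic_of_rat a) + B%:~R)).
  rewrite -zE sub0r -[LHS]subr0 -e /s !(rmorphD, rmorphM, rmorphXn) /=; ring.
rewrite padic_normM; apply: le_lt_trans xa.
rewrite ler_piMr ?padic_norm_ge0 //.
apply: le_trans (padic_normB _ _) _; rewrite padic_norm0 ge_max ler01 /=.
apply: le_trans (padic_normD _ _) _; rewrite padic_norm_int ge_max.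
rewrite padic_abs_int_le1 andbT padic_normM padic_norm_int A1 mul1r.
by apply: le_trans (padic_normD _ _) _; rewrite ge_max x1 padic_norm_rat.
Qed.

(** * Bounding the primes *)

Lemma quadratic_gt0_large (A B C z : int) : 0 < A -> `|B| + `|C| + 1 <= z ->
  0 < A * z ^+ 2 + B * z + C /\ 0 < 2 * A * z + B.
Proof. by move=> A0 zT; split; nia. Qed.

Lemma quadratic_le_small (A B C z T : int) : 0 < A -> 0 <= z <= T ->
  `|A * z ^+ 2 + B * z + C| <= A * T ^+ 2 + `|B| * T + `|C|.
Proof.
move=> A0 /andP[z0 zT].
apply: le_trans (ler_normD _ _) _; rewrite lerD2r.
apply: le_trans (ler_normD _ _) _; rewrite !normrM (gtr0_norm A0).
rewrite (ger0_norm z0) -expr2; apply: lerD.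
  by rewrite ler_pM2l // lerXn2r ?nnegrE // (le_trans z0).
by rewrite ler_wpM2l.
Qed.

(** From [T] on the values of the polynomial and of its derivative are positive,
    and up to [T] the polynomial is at most [M - A] in absolute value.  So a
    prime [p > M] divides no nonzero value at a [z <= T], which forces [z > T]
    for the first partial quotient [z]; the summand [A] of [M] ensures that [p]
    does not divide the leading coefficient. *)
Lemma ruban_periodic_prime_bounded (A B C : int) : 0 < A ->
  (forall q : rat, A%:~R * q ^+ 2 + B%:~R * q + C%:~R != 0) ->
  exists M : nat, forall (p : nat) (x : padic p), prime p ->
    A%:~R * x ^+ 2 + B%:~R * x + C%:~R = 0 -> ruban_periodic x -> (p < M)%N.
Proof.
move=> A0 irr; pose T := `|B| + `|C| + 1.
pose M := A + (A * T ^+ 2 + `|B| * T + `|C|).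
exists `|M|.+1%N => p x pp xroot [inf [N [k [k0 per]]]].
rewrite ltnS leqNgt; apply/negP => Mp.
have T0 : 0 <= T by rewrite /T; lia.
have F0 : 0 <= A * T ^+ 2 + `|B| * T + `|C|.
  by rewrite !addr_ge0 // ?mulr_ge0 ?exprn_ge0 // ltW.
have Ap : (0 < `|A| < p)%N by apply/andP; split; rewrite /M in Mp; lia.
have A1 : padic_abs p A%:~R = 1.
  by have := padic_abs_coprime Ap; rewrite pmulrn gtz0_abs.
have [c [a [cx rc aZ ra]]] := ruban_infinite pp inf.
have [c0 cE fl a0] := rc.
rewrite -cx in xroot.
have [z az pz] := integral_floor_dvd pp A1 xroot aZ (fl 0%N).
have z0 : 0 <= z by rewrite -(ler0z rat) -az.
have fz0 : A * z ^+ 2 + B * z + C != 0.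
  rewrite -(intr_eq0 rat) !(rmorphD, rmorphM, rmorphXn) /=; exact: irr.
have zT : T <= z.
  rewrite leNgt; apply/negP => zT.
  have zle : 0 <= z <= T by rewrite z0 ltW.
  have := quadratic_le_small B C A0 zle.
  have := dvdn_leq _ pz; rewrite absz_gt0 => /(_ fz0).
  by move: Mp; rewrite /M; lia.
have [f0 f'0] := quadratic_gt0_large A0 zT.
have pos1 : pos_quadratic_root padic_of_rat (c 1%N).
  exists (A * z ^+ 2 + B * z + C)%:~R, (2 * A * z + B)%:~R, A%:~R.
  split; rewrite ?ltr0z //.
  rewrite -(rmorph_int padic_of_rat A) -(rmorph_int padic_of_rat B)
    -(rmorph_int padic_of_rat C) in xroot.
  have := quadratic_step (c0 0%N) (cE 0%N) xroot.
  by rewrite az !(rmorphD, rmorphM, rmorphXn).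
have aper n : (N <= n)%N -> a (n + k)%N = a n.
  by move=> /per; rewrite !ra => -[].
have [q cq] := ruban_periodic_pos_root_rational pp rc k0 aper pos1.
have := irr q; rewrite -(fmorph_eq0 (@padic_of_rat p)).
rewrite !(rmorphD, rmorphM, rmorphXn) /= !rmorph_int -cq => /eqP.
by apply.
Qed.

Lemma irreducible_quadratic_no_root (F : fieldType) (A B C q : F) : A != 0 ->
  irreducible_poly (A *: 'X^2 + B *: 'X + C%:P) ->
  A * q ^+ 2 + B * q + C != 0.
Proof.
move=> A0 [_ irr]; apply/negP => /eqP e.
set f := _ + _ in irr.
have fq : root f q by apply/eqP; rewrite -[RHS]e /f !hornerE ?expr2.
have := irr ('X - q%:P); rewrite size_XsubC dvdp_XsubCl fq => /(_ isT isT).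
move=> /eqp_size; rewrite size_XsubC /f -addrA size_polyDl size_scale //.
  by rewrite size_polyXn.
rewrite size_polyXn; apply: leq_ltn_trans (size_polyD _ _) _.
rewrite gtn_max (leq_ltn_trans (size_scale_leq _ _)) ?size_polyX //.
by rewrite (leq_ltn_trans (size_polyC_leq1 _)).
Qed.

Lemma map_quadratic (F : fieldType) (A B C : int) :
  map_poly (fun z : int => z%:~R : F) (A *: 'X^2 + B *: 'X + C%:P) =
  A%:~R *: 'X^2 + B%:~R *: 'X + (C%:~R)%:P.
Proof.
rewrite -[map_poly _]/(map_poly intr).
by rewrite !rmorphD /= !map_polyZ /= map_polyXn map_polyX map_polyC.
Qed.

Theorem corollary6p12 (A B C : int) (f : {poly int})
    (hf : f = A *: 'X^2 + B *: 'X + C%:P) (hA : A != 0)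
    (f_irr : irreducible_poly (map_poly (fun z : int => z%:~R : rat) f)) :
  finite_set [set l : nat | prime l /\
    exists x : padic l,
      root (map_poly (fun z : int => z%:~R : padic l) f) x /\
      ruban_periodic x].
Proof.
have noroot (q : rat) : A%:~R * q ^+ 2 + B%:~R * q + C%:~R != 0.
  by apply: irreducible_quadratic_no_root; rewrite ?intr_eq0 // -map_quadratic -hf.
suff [M hM] : exists M : nat, forall (p : nat) (x : padic p), prime p ->
    A%:~R * x ^+ 2 + B%:~R * x + C%:~R = 0 -> ruban_periodic x -> (p < M)%N.
  apply: sub_finite_set (finite_II M) => l [pl [x [xroot xper]]] /=.
  apply: hM pl _ xper; move: xroot.
  by rewrite hf map_quadratic /root !hornerE => /eqP.
have [A0|A0|A0] := ltgtP A 0; last by rewrite A0 eqxx in hA.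
- have [||M hM] := @ruban_periodic_prime_bounded (- A) (- B) (- C).
  + by rewrite oppr_gt0.
  + by move=> q; rewrite !rmorphN !mulNr -!opprD oppr_eq0.
  exists M => p x pp e; apply: hM => //.
  by rewrite !rmorphN !mulNr -!opprD e oppr0.
- exact: ruban_periodic_prime_bounded.
Qed.
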